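(* Let $a$ be a non-zero element of a right B\'ezout domain $R$. Then: (1) The principal right ideal $aR$ has a serial factorization if and only if either $a$ is invertible, or $a$ is rigid, or $a$ is semirigid. (2) If $a=a_1\cdots a_n$ is a rigid factorization of a semirigid element $a$, then $aR=(a_1R)\cdots (a_nR)$ is a serial factorization of $aR$. (3) Conversely, if $aR=A_1\cdots A_n$ is a serial factorization of $aR$, where $n\geq 2$, then there exist $a_1,\dots,a_n\in R$ such that $A_i=a_iR$ for every $i$ and $a=a_1\cdots a_n$ is a rigid factorization of $a$, so that $a$ is a semirigid element of $R$.
   Context: Rings are associative with identity $1\neq 0$, and integral domains are not necessarily commutative. A right B\'ezout domain is an integral domain in which every finitely generated right ideal is principal. The product $IJ$ of two right ideals is the set of finite sums of products $xy$ with $x\in I$, $y\in J$. A right module is uniserial if its lattice of submodules is linearly ordered by inclusion. A finite family $\{A_1,\dots,A_n\}$ of proper right ideals of $R$ is coindependent if $A_i+\bigcap_{j\neq i}A_j=R$ for every $i$ (an empty intersection being $R$). A serial factorization of a right ideal $A$ of $R$ is a factorization $A=A_1\cdots A_n$ where $A_1,\dots,A_n$ are proper right ideals of $R$ forming a coindependent family, $A_iA_j=A_jA_i$ for all $i,j$, and $R/A_i$ is a uniserial right $R$-module for every $i$. The improper ideal $R$ is regarded as having the empty serial factorization ($n=0$). Let $R$ be an integral domain. An element $a\in R$ is right invariant if $Ra\subseteq aR$. Elements $a,b\in R$ are right associates if $a=bu$ for some invertible $u\in R$. An element $a\in R$ is rigid if it is non-zero, non-invertible, and for all $x,y,x',y'\in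 R$, $a=xy'=yx'$ implies $x=yu$ or $y=xu$ for some $u\in R$. An element $a\in R$ is semirigid if $a$ is not rigid and $a$ has a factorization $a=a_1\cdots a_n$ (necessarily with $n\ge 2$) such that: each $a_i$ is right invariant and rigid; $a_iR+a_jR=R$ for all $i\neq j$; and $a_ia_j$ and $a_ja_i$ are right associates for all $i,j$. Such a factorization of a semirigid element is called a rigid factorization. *)

(* Defs.v *)
From HB Require Import structures.
From mathcomp Require Import all_boot all_algebra.
From mathcomp Require Import boolp classical_sets.

Set Implicit Arguments.
Unset Strict Implicit.
Unset Printing Implicit Defensive.

Import GRing.Theory.
Local Open Scope classical_set_scope.
Local Open Scope ring_scope.
Local Open Scope quotient_scope.

(* Right ideals are not assumed decidable, hence subsets [set R] rather than
   the boolean predicates of [ring_quotient] (whose [idealr] is moreover closed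
   under multiplication on the left). *)
Record rightIdeal (R : nzRingType) := RightIdeal {
  ri_set :> set R;
  ri0 : ri_set 0;
  riD : forall x y, ri_set x -> ri_set y -> ri_set (x + y);
  riMr : forall x r, ri_set x -> ri_set (x * r)
}.

(* The quotient right module R/A.  Right R-modules are left modules over the
   converse ring R^c. *)
Section RightQuotient.
Variables (R : nzRingType) (A : rightIdeal R).

Definition ri_pred : {pred R} := fun x => `[< ri_set A x >].

Lemma ri_pred_zmod_closed : zmod_closed ri_pred.
Proof.
split=> [|x y /asboolP Ax /asboolP Ay]; apply/asboolP; first exact: ri0.
by apply: riD => //; rewrite -mulrN1; apply: riMr.
Qed.

HB.instance Definition _ :=
  GRing.isZmodClosed.Build R ri_pred ri_pred_zmod_closed.

Definition rquot : Type := Quotient.quot ri_pred.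

HB.instance Definition _ := GRing.Zmodule.on rquot.

Definition rquot_pi (x : R) : rquot := \pi_(Quotient.quot ri_pred) x.

Definition rquot_scale (r : R^c) (v : rquot) : rquot :=
  rquot_pi (repr (v : Quotient.quot ri_pred) * (r : R)).

Lemma rquot_ind (P : rquot -> Prop) : (forall x, P (rquot_pi x)) -> forall v, P v.
Proof. by move=> H v; have := H (repr (v : Quotient.quot ri_pred)); rewrite /rquot_pi reprK. Qed.

Lemma rquot_piP x y : rquot_pi x = rquot_pi y <-> ri_set A (x - y).
Proof.
split=> [/eqP|Axy]; last apply/eqP; rewrite -Quotient.idealrBE.
  by move/asboolP.
exact/asboolP.
Qed.

Lemma rquot_piD x y : rquot_pi (x + y) = rquot_pi x + rquot_pi y.
Proof. by rewrite /rquot_pi !piE. Qed.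

Lemma rquot_piZ (r x : R) : rquot_scale r (rquot_pi x) = rquot_pi (x * r).
Proof.
apply/rquot_piP; rewrite -mulrBl; apply: riMr.
by apply/rquot_piP; rewrite /rquot_pi reprK.
Qed.

Lemma rquot_scaleA (r s : R^c) v :
  rquot_scale r (rquot_scale s v) = rquot_scale (r * s) v.
Proof. by elim/rquot_ind: v => x; rewrite !rquot_piZ mulrA. Qed.

Lemma rquot_scale1 : left_id (1 : R^c) rquot_scale.
Proof. by elim/rquot_ind => x; rewrite rquot_piZ mulr1. Qed.

Lemma rquot_scaleDr : right_distributive rquot_scale +%R.
Proof.
move=> r; elim/rquot_ind => x; elim/rquot_ind => y.
by rewrite -rquot_piD !rquot_piZ mulrDl rquot_piD.
Qed.

Lemma rquot_scaleDl v : {morph rquot_scale^~ v : r s / r + s}.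
Proof.
by elim/rquot_ind: v => x r s; rewrite !rquot_piZ mulrDr rquot_piD.
Qed.

HB.instance Definition _ := GRing.Zmodule_isLmodule.Build R^c rquot
  rquot_scaleA rquot_scale1 rquot_scaleDr rquot_scaleDl.

End RightQuotient.

Definition uniserial (S : nzRingType) (M : lmodType S) : Prop :=
  forall N P : {pred M}, submod_closed N -> submod_closed P ->
    {subset N <= P} \/ {subset P <= N}.

Section Ideals.
Variable R : nzRingType.
Implicit Types I J : set R.

Definition ideal_add I J : set R := [set z | exists2 x, I x & exists2 y, J y & z = x + y].

Definition ideal_mul I J : set R :=
  [set z | exists (n : nat) (x y : 'I_n -> R),
     [/\ forall i, I (x i), forall i, J (y i) & z = \sum_(i < n) x i * y i]].

(* [\big] associates to the right, so this is A_1 (A_2 (... (A_n R))), where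
   A_n R = A_n for a right ideal A_n; the empty product is R. *)
Definition ideal_prod n (A : 'I_n -> rightIdeal R) : set R :=
  \big[ideal_mul/setT]_(i < n) (A i : set R).

Definition proper_right_ideal I : Prop := I <> setT.

Definition coindependent n (A : 'I_n -> rightIdeal R) : Prop :=
  (forall i, proper_right_ideal (A i)) /\
  forall i, ideal_add (A i) (\bigcap_(j in [set j | j != i]) A j) = setT.

Definition serial_factorization (I : set R) n (A : 'I_n -> rightIdeal R) : Prop :=
  [/\ I = ideal_prod A,
      coindependent A,
      forall i j, ideal_mul (A i) (A j) = ideal_mul (A j) (A i)
    & forall i, @uniserial R^c (rquot (A i))].

Definition has_serial_factorization (I : set R) : Prop :=
  exists (n : nat) (A : 'I_n -> rightIdeal R), serial_factorization I A.

Definition principal_set (a : R) : set R := [set a * r | r in setT].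

Lemma principal0 a : principal_set a 0.
Proof. by exists 0; rewrite ?mulr0. Qed.

Lemma principalD a x y :
  principal_set a x -> principal_set a y -> principal_set a (x + y).
Proof. by move=> [r _ <-] [s _ <-]; exists (r + s); rewrite ?mulrDr. Qed.

Lemma principalM a x r : principal_set a x -> principal_set a (x * r).
Proof. by move=> [s _ <-]; exists (s * r); rewrite ?mulrA. Qed.

Definition principal (a : R) : rightIdeal R :=
  RightIdeal (principal0 a) (@principalD a) (@principalM a).

Definition finitely_generated I : Prop :=
  exists (n : nat) (x : 'I_n -> R),
    I = [set z | exists r : 'I_n -> R, z = \sum_(i < n) x i * r i].

(* MathComp's [idomainType] is commutative. *)
Definition integral_domain : Prop := forall x y : R, x * y = 0 -> x = 0 \/ y = 0.

Definition right_Bezout_domain : Prop :=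
  integral_domain /\
  forall I : rightIdeal R, finitely_generated I -> exists d, I = principal d :> set R.

End Ideals.

Section Elements.
Variable R : nzRingType.
Implicit Types a b : R.

Definition invertible a : Prop := exists b, a * b = 1 /\ b * a = 1.

Definition right_invariant a : Prop := [set r * a | r in setT] `<=` principal a.

Definition right_associates a b : Prop := exists2 u, invertible u & a = b * u.

Definition rigid a : Prop :=
  [/\ a <> 0, ~ invertible a
    & forall x y x' y', a = x * y' -> a = y * x' ->
        exists u, x = y * u \/ y = x * u].

(* The length bound excludes the empty product 1; for a non-rigid [a], length 1
   is impossible anyway. *)
Definition rigid_factorization a n (b : 'I_n -> R) : Prop :=
  [/\ (2 <= n)%N,
      a = \prod_(i < n) b i,
      forall i, right_invariant (b i) /\ rigid (b i),
      forall i j, i != j -> ideal_add (principal (b i)) (principal (b j)) = setT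
    & forall i j, right_associates (b i * b j) (b j * b i)].

Definition semirigid a : Prop :=
  ~ rigid a /\ exists (n : nat) (b : 'I_n -> R), rigid_factorization a b.

End Elements.

(* Main.v *)
(** A right ideal [aR] is proper with uniserial quotient exactly when [a] is
    rigid, because in a Bezout domain two incomparable right ideals above [aR]
    yield two incomparable principal ones.  In a serial factorization with at
    least two factors every [A_i] is two-sided, since
    [R A_i = (A_i + A_j) A_i = A_i A_i + A_i A_j], so the product of the [A_i]
    is their intersection.  Writing [1 = x + y] with [x] in [A_i] and [y] in all
    the other [A_j] gives [A_i = xR + aR], which is therefore principal. *)

Require Import Defs.
From mathcomp Require Import all_boot all_algebra.
From mathcomp Require Import boolp classical_sets.

Set Implicit Arguments.
Unset Strict Implicit.
Unset Printing Implicit Defensive.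

Import GRing.Theory.
Local Open Scope ring_scope.

(** * Sums, products and intersections of right ideals in an arbitrary ring *)

Section RightIdeals.
Local Open Scope classical_set_scope.
Variable R : nzRingType.
Implicit Types (I J K : set R) (A B C : rightIdeal R) (a b : R).

Definition left_stable I : Prop := forall r x, I x -> I (r * x).

Lemma ri_sum A n (x : 'I_n -> R) : (forall i, ri_set A (x i)) ->
  ri_set A (\sum_(i < n) x i).
Proof. by move=> Ax; apply: big_ind => //; [apply: ri0 | apply: riD]. Qed.

Lemma proper_right_idealP A : proper_right_ideal A <-> ~ ri_set A 1.
Proof.
split=> [A_neqT A1|A1 AT]; last by apply: A1; rewrite AT.
by apply: A_neqT; rewrite -subTset => x _; rewrite -(mul1r x); apply: riMr.
Qed.

Lemma ideal_addT1 A B :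
  ideal_add A B = setT <-> exists x y, [/\ ri_set A x, ri_set B y & 1 = x + y].
Proof.
split=> [AB|[x [y [Ax By xy1]]]].
  have : ideal_add A B 1 by rewrite AB.
  by case=> x Ax [y By ->]; exists x, y.
rewrite -subTset => r _; exists (x * r); first exact: riMr.
by exists (y * r); [apply: riMr | rewrite -mulrDl -xy1 mul1r].
Qed.

Lemma ideal_mul0 I J : ideal_mul I J 0.
Proof.
exists 0%N, (fun=> 0), (fun=> 0).
by split; [case | case | rewrite big_ord0].
Qed.

(** The two finite sums of products are concatenated into one of length [m + n]. *)
Lemma ideal_mulD I J x y :
  ideal_mul I J x -> ideal_mul I J y -> ideal_mul I J (x + y).
Proof.
move=> [m [u [v [Iu Jv ->]]]] [n [u' [v' [Iu' Jv' ->]]]].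
pose glue (f : 'I_m -> R) (g : 'I_n -> R) (i : 'I_(m + n)) :=
  match split i with inl j => f j | inr k => g k end.
exists (m + n)%N, (glue u u'), (glue v v'); split.
- by move=> i; rewrite /glue; case: split.
- by move=> i; rewrite /glue; case: split.
rewrite big_split_ord /glue; congr (_ + _); apply: eq_bigr => i _.
  by rewrite (unsplitK (inl i)).
by rewrite (unsplitK (inr i)).
Qed.

Lemma ideal_mulM I J x y : I x -> J y -> ideal_mul I J (x * y).
Proof.
by move=> Ix Jy; exists 1%N, (fun=> x), (fun=> y); split; rewrite ?big_ord1.
Qed.

Lemma ideal_mul_sum I J n (x : 'I_n -> R) :
  (forall i, ideal_mul I J (x i)) -> ideal_mul I J (\sum_(i < n) x i).
Proof.
by move=> Hx; apply: big_ind => //; [apply: ideal_mul0 | apply: ideal_mulD].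
Qed.

Lemma ideal_mulS I J I' J' :
  I `<=` I' -> J `<=` J' -> ideal_mul I J `<=` ideal_mul I' J'.
Proof.
move=> sI sJ z [n [x [y [Ix Jy ->]]]].
by apply: ideal_mul_sum => i; apply: ideal_mulM; [apply: sI | apply: sJ].
Qed.

Lemma ideal_mulA I J K :
  ideal_mul (ideal_mul I J) K = ideal_mul I (ideal_mul J K).
Proof.
rewrite eqEsubset; split=> z [n [x [y [Hx Hy ->]]]]; apply: ideal_mul_sum => i.
  have [m [u [v [Iu Jv ->]]]] := Hx i.
  rewrite mulr_suml; apply: ideal_mul_sum => j.
  by rewrite -mulrA; do 2?apply: ideal_mulM.
have [m [u [v [Ju Kv ->]]]] := Hy i.
rewrite mulr_sumr; apply: ideal_mul_sum => j.
by rewrite mulrA; do 2?apply: ideal_mulM.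
Qed.

(** This absorbs the [setT] that ends an [ideal_prod]. On the left, [setT] would instead produce the
    two-sided ideal generated by [A]. *)
Lemma ideal_mulrT A : ideal_mul A setT = A.
Proof.
rewrite eqEsubset; split=> [_ [n [x [y [Ax _ ->]]]]|x Ax].
  by apply: ri_sum => i; apply: riMr.
by rewrite -(mulr1 x); apply: ideal_mulM.
Qed.

(** Packaged as a right ideal so that [ideal_addT1] applies to coindependence; transparent so that
    it unfolds to the intersection. *)
Definition ri_bigcap (n : nat) (A : 'I_n -> rightIdeal R) (D : set 'I_n) :
  rightIdeal R.
Proof.
apply: (@RightIdeal _ (\bigcap_(j in D) A j)).
- by move=> j _; apply: ri0.
- by move=> x y Hx Hy j Dj; apply: riD; [apply: Hx | apply: Hy].
- by move=> x r Hx j Dj; apply: riMr; apply: Hx.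
Defined.

Definition ri_add A B : rightIdeal R.
Proof.
apply: (@RightIdeal _ (ideal_add A B)).
- by exists 0; [apply: ri0 | exists 0; [apply: ri0 | rewrite addr0]].
- move=> _ _ [x Ax [y By ->]] [x' Ax' [y' By' ->]].
  exists (x + x'); first exact: riD.
  by exists (y + y'); [apply: riD | rewrite addrACA].
- move=> _ r [x Ax [y By ->]]; exists (x * r); first exact: riMr.
  by exists (y * r); [apply: riMr | rewrite mulrDl].
Defined.

Lemma ideal_addl A B : A `<=` ideal_add A B.
Proof.
by move=> x Ax; exists x => //; exists 0; [apply: ri0 | rewrite addr0].
Qed.

Lemma ideal_addr A B : B `<=` ideal_add A B.
Proof. by move=> y By; exists 0; [apply: ri0 | exists y; rewrite ?add0r]. Qed.

Lemma principal_id a : ri_set (principal a) a.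
Proof. by exists 1; rewrite ?mulr1. Qed.

Lemma principal_sub a A : principal a `<=` A <-> ri_set A a.
Proof.
split=> [|Aa _ [r _ <-]]; first by apply; apply: principal_id.
exact: riMr.
Qed.

Lemma right_invariant_left_stable a :
  right_invariant a <-> left_stable (principal a).
Proof.
split=> [inv r _ [s _ <-]|st _ [r _ <-]].
  2: by apply: st; apply: principal_id.
by rewrite mulrA; apply: principalM; apply: inv; exists r.
Qed.

Lemma right_invariantM a b :
  right_invariant a -> right_invariant b -> right_invariant (a * b).
Proof.
move=> inva invb _ [r _ <-].
have [s _ Es] : ri_set (principal a) (r * a) by apply: inva; exists r.
have [t _ Et] : ri_set (principal b) (s * b) by apply: invb; exists s.
by exists t => //; rewrite -mulrA Et !mulrA Es.
Qed.

(** Invariance of [b] moves the inner scalar to the right: [a * r * (b * s)] becomes [a * b * t]. *)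
Lemma ideal_mul_principal a b : right_invariant b ->
  ideal_mul (principal a) (principal b) = principal (a * b).
Proof.
move=> /right_invariant_left_stable st; rewrite eqEsubset; split.
  move=> _ [n [x [y [ax bY ->]]]]; apply: ri_sum => i.
  have [r _ <-] := ax i; have [s _ Es] := st r _ (bY i).
  by rewrite -mulrA -Es mulrA; exists s.
by move=> _ [r _ <-]; rewrite -mulrA; apply: ideal_mulM;
  [apply: principal_id | exists r].
Qed.

Lemma ideal_prod_principal n (b : 'I_n -> R) :
  (forall i, right_invariant (b i)) ->
  ideal_prod (fun i => principal (b i)) = principal (\prod_(i < n) b i).
Proof.
move=> invb; rewrite /ideal_prod.
(* Invariance of the partial product is carried along, since it is the right factor in each use of
   [ideal_mul_principal]. *)
suff [] : right_invariant (\prod_(i < n) b i) /\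
  \big[@ideal_mul R/setT]_(i < n) (principal (b i) : set R) =
    principal (\prod_(i < n) b i) by [].
elim/big_rec2: _ => [|i b' I _ [invb' ->]]; last first.
  by rewrite ideal_mul_principal //; split => //; apply: right_invariantM.
split; first by move=> _ [r _ <-]; exists r; rewrite ?mulr1 ?mul1r.
by rewrite eqEsubset; split=> // r _; exists r; rewrite ?mul1r.
Qed.

(** The correspondence between submodules of [R/A] and right ideals above [A]. The right-hand side
    depends only on the underlying set of [A]. *)
Lemma uniserialP A : @uniserial R^c (rquot A) <->
  forall I J : rightIdeal R, A `<=` I -> A `<=` J -> I `<=` J \/ J `<=` I.
Proof.
have pi0 : rquot_pi A 0 = 0.
  by apply: (addrI (rquot_pi A 0)); rewrite -rquot_piD !addr0.
split=> [unA I J sAI sAJ|cmp N P].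
  pose img (B : rightIdeal R) : {pred rquot A} :=
    fun v => `[< exists2 z, ri_set B z & v = rquot_pi A z >].
  have imgE (B : rightIdeal R) : A `<=` B ->
      forall z, rquot_pi A z \in img B -> ri_set B z.
    move=> sAB z /asboolP [w Bw /rquot_piP Azw].
    by rewrite -(subrK w z); apply: riD => //; apply: sAB.
  have imgP (B : rightIdeal R) z : ri_set B z -> rquot_pi A z \in img B.
    by move=> Bz; apply/asboolP; exists z.
  have img_closed (B : rightIdeal R) : submod_closed (img B).
    split=> [|r u v /asboolP [x Bx ->] /asboolP [y By ->]]; apply/asboolP.
      by exists 0; [apply: ri0 | rewrite pi0].
    exists (x * r + y); first by apply: riD => //; apply: riMr.
    by rewrite rquot_piD -rquot_piZ.
  have [sIJ|sJI] := unA _ _ (img_closed I) (img_closed J); [left|right] => x Hx.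
    by apply: imgE sAJ _ _; apply: sIJ; apply: imgP.
  by apply: imgE sAI _ _; apply: sJI; apply: imgP.
have preim (Q : {pred rquot A}) : submod_closed Q ->
    exists B : rightIdeal R,
      A `<=` B /\ forall x, ri_set B x <-> rquot_pi A x \in Q.
  move=> [Q0 Qlin].
  have B0 : rquot_pi A 0 \in Q by rewrite pi0.
  have BD x y : rquot_pi A x \in Q -> rquot_pi A y \in Q ->
      rquot_pi A (x + y) \in Q.
    (* [submod_closed] speaks of [r *: u + v]: scalar [1] gives sums, and [v = 0] gives
       multiples. *)
    by move=> Qx Qy; rewrite rquot_piD -(scale1r (rquot_pi A x)); apply: Qlin.
  have BM x r : rquot_pi A x \in Q -> rquot_pi A (x * r) \in Q.
    move=> Qx; rewrite -rquot_piZ -[rquot_scale _ _]addr0.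
    exact: (Qlin (r : R^c)).
  exists (@RightIdeal _ [set x | rquot_pi A x \in Q] B0 BD BM); split=> // x Ax.
  have /rquot_piP Ex : ri_set A (x - 0) by rewrite subr0.
  by rewrite /= Ex pi0.
move=> /preim [I [sAI NE]] /preim [J [sAJ PE]].
have [sIJ|sJI] := cmp I J sAI sAJ; [left|right]; elim/rquot_ind => x.
  by move=> /NE /sIJ /PE.
by move=> /PE /sJI /NE.
Qed.

Lemma coindependent_pair n (A : 'I_n -> rightIdeal R) i j :
  coindependent A -> i != j -> ideal_add (A i) (A j) = setT.
Proof.
move=> [_ /(_ i) coA] neq_ij; apply/ideal_addT1.
have /(ideal_addT1 (A i) (ri_bigcap A _)) [x [y [Ax Ay xy1]]] := coA.
by exists x, y; split=> //; apply: Ay; rewrite /= eq_sym.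
Qed.

(** * Pairwise comaximal two-sided ideals: intersections and products *)

Section Comaximal.
Variables (n : nat) (A : 'I_n -> rightIdeal R).
Hypothesis stA : forall i, left_stable (A i).
Hypothesis coA : forall i j, i != j -> ideal_add (A i) (A j) = setT.

(** As for the Chinese remainder theorem, [1 = x + y] and [1 = x' + y'] combine to
    [1 = (x + y * x') + y * y']; left stability keeps [y * x'] in [A i] and [y * y'] in [A j]. *)
Lemma comaximal_bigcap i (s : seq 'I_n) : i \notin s ->
  ideal_add (A i) (\bigcap_(j in [set` s]) A j) = setT.
Proof.
elim: s => [_|j s IHs].
  apply/(ideal_addT1 _ (ri_bigcap A _)); exists 0, 1; rewrite add0r.
  by split=> //; apply: ri0.
rewrite inE negb_or => /andP[neq_ij /IHs].
move=> /(ideal_addT1 (A i) (ri_bigcap A _)) [x [y [Ax Ay xy1]]].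
have /ideal_addT1 [x' [y' [Ax' Ay' xy1']]] := coA neq_ij.
apply/(ideal_addT1 (A i) (ri_bigcap A _)).
exists (x + y * x'), (y * y'); split.
- by apply: riD => //; apply: stA.
- move=> k /=; rewrite inE => /predU1P[->|ks]; first exact: stA.
  by apply: riMr; apply: Ay.
- by rewrite -addrA -mulrDr -xy1' mulr1.
Qed.

Hypothesis comA : forall i j, ideal_mul (A i) (A j) = ideal_mul (A j) (A i).

(** [A i] is moved leftwards past one factor at a time. Only an inclusion is claimed; for the empty
    product it is left stability of [A i]. *)
Lemma ideal_prod_commute i (s : seq 'I_n) :
  ideal_mul (\big[@ideal_mul R/setT]_(j <- s) (A j : set R)) (A i) `<=`
  ideal_mul (A i) (\big[@ideal_mul R/setT]_(j <- s) (A j : set R)).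
Proof.
elim: s => [|j s IHs].
  rewrite big_nil ideal_mulrT => _ [m [x [y [_ Ay ->]]]].
  by apply: ri_sum => k; apply: stA.
rewrite big_cons -[X in _ `<=` X]ideal_mulA comA !ideal_mulA.
exact: ideal_mulS.
Qed.

(* As [1 = u + v] with [u] in [A_i] and [v] in the product [P] of the other
   factors, [z = z u + z v] lies in [P A_i + A_i P]. *)
Lemma bigcap_sub_ideal_prod : \bigcap_i A i `<=` ideal_prod A.
Proof.
suff sub s : uniq s -> \bigcap_(j in [set` s]) A j `<=`
    \big[@ideal_mul R/setT]_(j <- s) (A j : set R).
  by move=> z Az; apply: sub (index_enum_uniq _) _ _ => j _; apply: Az.
elim: s => [|i s IHs]; first by rewrite big_nil.
rewrite cons_uniq big_cons => /andP[/comaximal_bigcap + /IHs sP] z Az.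
move=> /(ideal_addT1 (A i) (ri_bigcap A _)) [u [v [Au Av uv1]]].
rewrite -(mulr1 z) uv1 mulrDr; apply: ideal_mulD.
  apply: ideal_prod_commute; apply: ideal_mulM => //; apply: sP => j js.
  by apply: Az; rewrite /= inE js orbT.
by apply: ideal_mulM; [apply: Az; rewrite /= mem_head | apply: sP].
Qed.

End Comaximal.

(** In [r * x = u * r * x + v * r * x] the first term lies in [A] because [u] does, and the second
    in [BA = AB], which is inside [A]. *)
Lemma commuting_comaximal_left_stable A B :
  ideal_add A B = setT -> ideal_mul A B = ideal_mul B A -> left_stable A.
Proof.
move=> /ideal_addT1 [u [v [Au Bv uv1]]] comAB r x Ax.
have : ideal_mul A B ((v * r) * x).
  by rewrite comAB; apply: ideal_mulM => //; apply: riMr.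
have ABsub : ideal_mul A B `<=` A.
  by rewrite -[X in _ `<=` X]ideal_mulrT; apply: ideal_mulS.
move=> /ABsub Avrx; rewrite -(mul1r r) uv1 !mulrDl; apply: riD => //.
by rewrite -mulrA; apply: riMr.
Qed.

(** A product lies in its leading factor because that is a right ideal, and in the later ones by
    left stability. *)
Lemma ideal_prod_sub n (A : 'I_n -> rightIdeal R) :
  (forall i, left_stable (A i)) -> ideal_prod A `<=` \bigcap_i A i.
Proof.
move=> stA z Pz i _; move: Pz; rewrite /ideal_prod.
have : i \in index_enum 'I_n by rewrite mem_index_enum.
elim: (index_enum _) z => // j s IHs z; rewrite inE big_cons.
move=> /predU1P[<-|js] [m [x [y [Ax Py ->]]]]; apply: ri_sum => k.
  exact: riMr.
by apply: stA; apply: IHs.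
Qed.

End RightIdeals.

(** * Principal right ideals and rigid elements in a right Bezout domain *)

Section BezoutDomain.
Local Open Scope classical_set_scope.
Variable R : nzRingType.
Hypothesis HR : right_Bezout_domain R.
Implicit Types (A : rightIdeal R) (a b : R).

Let domR : integral_domain R := HR.1.

Lemma domain_mulrI a x y : a <> 0 -> a * x = a * y -> x = y.
Proof.
move=> a0 /eqP; rewrite -subr_eq0 -mulrBr => /eqP /domR [//|/eqP].
by rewrite subr_eq0 => /eqP.
Qed.

(** A right inverse is two-sided in a domain: [a * b = 1] gives [a * (b * a) = a], and [a]
    cancels. *)
Lemma invertible_principal a : invertible a <-> ri_set (principal a) 1.
Proof.
split=> [[b [ab1 _]]|[b _ ab1]]; first by exists b.
have a0 : a <> 0 by move=> a0; have := oner_neq0 R; rewrite -ab1 a0 mul0r eqxx.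
by exists b; split=> //; apply: (domain_mulrI a0);
  rewrite mulrA ab1 mul1r mulr1.
Qed.

Lemma principal_right_associates a b : a <> 0 ->
  principal a = principal b :> set R -> right_associates a b.
Proof.
move=> a0 Eab.
have [u _ Eu] : ri_set (principal b) a by rewrite -Eab; apply: principal_id.
have [v _ Ev] : ri_set (principal a) b by rewrite Eab; apply: principal_id.
have uv1 : u * v = 1.
  apply: (@domain_mulrI b); last by rewrite mulrA Eu Ev mulr1.
  by move=> b0; apply: a0; rewrite -Eu b0 mul0r.
have vu1 : v * u = 1 by apply: (domain_mulrI a0); rewrite mulrA Ev Eu mulr1.
by exists u; [exists v | rewrite Eu].
Qed.

Lemma right_associates_principal a b :
  right_associates a b -> principal a = principal b :> set R.
Proof.
move=> [u [v [uv1 _]] ->]; rewrite eqEsubset; split; apply/principal_sub.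
  by exists u.
by exists v; rewrite // -mulrA uv1 mulr1.
Qed.

Lemma ideal_add_principal a b :
  exists d, ideal_add (principal a) (principal b) = principal d.
Proof.
apply: (HR.2 (ri_add (principal a) (principal b))).
exists 2%N, (fun i : 'I_2 => if i == ord0 then a else b).
rewrite eqEsubset; split=> z /=.
  move=> [_ [r _ <-] [_ [s _ <-] ->]].
  exists (fun i : 'I_2 => if i == ord0 then r else s).
  by rewrite big_ord_recl big_ord1.
move=> [r ->]; rewrite big_ord_recl big_ord1.
by exists (a * r ord0); [exists (r ord0) | exists (b * r (lift ord0 ord0));
  [exists (r (lift ord0 ord0)) | ]].
Qed.

Lemma rigid_uniserial a : a <> 0 -> rigid a <->
  proper_right_ideal (principal a) /\ @uniserial R^c (rquot (principal a)).
Proof.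
move=> a0; split=> [[_ ninv cmp]|[/proper_right_idealP pra /uniserialP cmp]].
  split; first by apply/proper_right_idealP => /invertible_principal.
  apply/uniserialP => I J sI sJ; apply: contrapT => /not_orP [].
  move=> /existsNP [x /not_implyP [Ix nJx]] /existsNP [y /not_implyP [Jy nIy]].
  (* Adding [a] to [x] and to [y] gives [dR] inside [I] and [eR] inside [J], both containing [a].
     Rigidity then compares [d] with [e], forcing [x] into [J] or [y] into [I]. *)
  have [d Ed] := ideal_add_principal x a.
  have [e Ee] := ideal_add_principal y a.
  have [Id xd ad] : [/\ ri_set I d,
      ri_set (principal d) x & ri_set (principal d) a].
    split; rewrite -?Ed; [|exact: ideal_addl (principal_id _)
                          |exact: ideal_addr (principal_id _)].
    have : ri_set (principal d) d by apply: principal_id.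
    rewrite -Ed => -[_ [r _ <-] [z az ->]].
    by apply: riD; [apply: riMr | apply: sI].
  have [Je ye ae] : [/\ ri_set J e,
      ri_set (principal e) y & ri_set (principal e) a].
    split; rewrite -?Ee; [|exact: ideal_addl (principal_id _)
                          |exact: ideal_addr (principal_id _)].
    have : ri_set (principal e) e by apply: principal_id.
    rewrite -Ee => -[_ [r _ <-] [z az ->]].
    by apply: riD; [apply: riMr | apply: sJ].
  case: ad ae xd ye => [r _ Er] [s _ Es] [r' _ Er'] [s' _ Es'].
  have [u [Eu|Eu]] := cmp d e s r (esym Er) (esym Es).
    by apply: nJx; rewrite -Er' Eu; do 2?apply: riMr.
  by apply: nIy; rewrite -Es' Eu; do 2?apply: riMr.
split=> //; first by move=> /invertible_principal.
move=> x y x' y' Ex Ey.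
(* Conversely, left factors of [a] generate right ideals above [aR], which are comparable. *)
have sx : principal a `<=` principal x by apply/principal_sub; exists y'.
have sy : principal a `<=` principal y by apply/principal_sub; exists x'.
have [/principal_sub [u _ <-]|/principal_sub [u _ <-]] := cmp _ _ sx sy.
  by exists u; left.
by exists u; right.
Qed.

(** Rigidity would place one of [bR], [cR] inside the other; the larger would then be [R] and its
    generator a unit. *)
Lemma not_rigid_comaximal a b c :
  ri_set (principal b) a -> ri_set (principal c) a ->
  ideal_add (principal b) (principal c) = setT ->
  ~ invertible b -> ~ invertible c -> ~ rigid a.
Proof.
move=> [r _ Er] [s _ Es] /ideal_addT1 [x [y [bx cy xy1]]] nb nc [_ _ cmp].
have [u [Eu|Eu]] := cmp b c s r (esym Er) (esym Es).
  apply/nc/invertible_principal; rewrite xy1; apply: principalD => //.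
  by case: bx => t _ <-; rewrite Eu -mulrA; exists (u * t).
apply/nb/invertible_principal; rewrite xy1; apply: principalD => //.
by case: cy => t _ <-; rewrite Eu -mulrA; exists (u * t).
Qed.

(** * Passage between rigid and serial factorizations *)

Lemma rigid_factorization_serial a n (b : 'I_n -> R) :
  rigid_factorization a b ->
  serial_factorization (principal a) (fun i => principal (b i)).
Proof.
move=> [_ Ea invrig coma assoc].
have invb i := (invrig i).1.
have unib i := (rigid_uniserial (let: And3 b0 _ _ := (invrig i).2 in b0)).1
  (invrig i).2.
split.
- by rewrite ideal_prod_principal // -Ea.
- split=> i; first exact: (unib i).1.
  (* The index set is listed as a sequence, so that pairwise comaximality yields coindependence. *)
  have -> : [set j | j != i] = [set` [seq j <- enum 'I_n | j != i]].
    by rewrite eqEsubset; split=> j /=; rewrite mem_filter mem_enum inE andbT.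
  apply: (@comaximal_bigcap _ _ (fun i => principal (b i))) => //.
    by move=> j; apply/right_invariant_left_stable.
  by rewrite mem_filter eqxx.
- move=> i j; rewrite !ideal_mul_principal //.
  exact: right_associates_principal.
- by move=> i; exact: (unib i).2.
Qed.

Lemma serial_factorization_principal a n (A : 'I_n -> rightIdeal R) :
  (2 <= n)%N -> serial_factorization (principal a) A ->
  (forall i, left_stable (A i)) /\
  forall i, exists b, A i = principal b :> set R.
Proof.
move=> n2 [Ea coA comA _].
have coA2 i j (neq_ij : i != j) := coindependent_pair coA neq_ij.
have stA i : left_stable (A i).
  have [j neq_ij] : exists j : 'I_n, i != j.
    case: n n2 {A Ea coA comA coA2} i => [|[|n]] // _ i.
    have [->|] := eqVneq i ord0; first by exists ord_max.
    by exists ord0.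
  exact: commuting_comaximal_left_stable (coA2 _ _ neq_ij) (comA i j).
split=> // i; have := coA.2 i.
move=> /(ideal_addT1 (A i) (ri_bigcap A _)) [x [y [Ax Ay xy1]]].
have Aa : ri_set (A i) a.
  by apply: (ideal_prod_sub stA) => //; rewrite -Ea; apply: principal_id.
have [d Ed] := ideal_add_principal x a; exists d; rewrite -Ed.
rewrite eqEsubset; split=> z; last first.
  move=> [_ [r _ <-] [_ [t _ <-] ->]].
  by apply: riD; apply: riMr.
(* Split [z = x * z + y * z]. The second term lies in [A i] by left stability and in every other
   [A j] through [y], hence in the product [aR]. *)
move=> Az; exists (x * z); first by exists z.
exists (y * z); last by rewrite -mulrDl -xy1 mul1r.
rewrite Ea; apply: bigcap_sub_ideal_prod => // j _.
have [->|neq_ji] := eqVneq j i; first exact: stA.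
by apply: riMr; apply: Ay.
Qed.

Lemma serial_factorization_rigid a n (A : 'I_n -> rightIdeal R) :
  a <> 0 -> (2 <= n)%N -> serial_factorization (principal a) A ->
  exists b : 'I_n -> R,
    (forall i, A i = principal (b i) :> set R) /\ rigid_factorization a b.
Proof.
move=> a0 n2 serA; have [stA prA] := serial_factorization_principal n2 serA.
have [Ea coA comA uniA] := serA.
have [b Eb] := choice prA.
(* Stated for any choice of generators: it serves both the initial family [b] and the corrected
   family [c]. *)
have invP (c : 'I_n -> R) : (forall i, A i = principal (c i) :> set R) ->
    forall i, right_invariant (c i).
  by move=> Ec i; apply/right_invariant_left_stable; rewrite -Ec.
have prodP (c : 'I_n -> R) : (forall i, A i = principal (c i) :> set R) ->
    principal a = principal (\prod_(i < n) c i) :> set R.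
  move=> Ec; rewrite Ea -ideal_prod_principal; last exact: invP.
  by rewrite /ideal_prod; under eq_bigr do rewrite Ec.
have [u uinv Eau] := principal_right_associates a0 (prodP b Eb).
have [c [Ec Eac]] : exists c : 'I_n -> R,
    (forall i, A i = principal (c i) :> set R) /\ a = \prod_(i < n) c i.
  case: n n2 A b Eau Eb {serA stA prA Ea coA comA uniA invP prodP} => // n _.
  move=> A b Eau Eb.
  (* The product of the [b i] equals [a] only up to a unit; the last generator absorbs [u] without
     changing its ideal. *)
  exists (fun i => if i == ord_max then b i * u else b i); split=> [i|].
    rewrite Eb; case: ifP => // _; apply/esym/right_associates_principal.
    by exists u.
  rewrite Eau !big_ord_recr /= eqxx mulrA; congr (_ * _ * _).
  by apply: eq_bigr => i _; rewrite -val_eqE /= ltn_eqF.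
(* A zero generator would force [a = 0], as [a] lies in every [A i]. *)
have c0 i : c i <> 0.
  move=> ci0; have : (\bigcap_i A i) a.
    by apply: (ideal_prod_sub stA); rewrite -Ea; apply: principal_id.
  by move=> /(_ i Logic.I); rewrite Ec ci0 => -[r _]; rewrite mul0r => /esym.
exists c; split=> //; split=> //.
- move=> i; split; first exact: invP.
  apply/rigid_uniserial => //; split; first by rewrite -Ec; apply: coA.1.
  (* The quotient type depends on the record and not just on its set, so the set equality is used
     through [uniserialP]. *)
  by apply/uniserialP; rewrite -Ec; apply/uniserialP.
- by move=> i j neq_ij; rewrite -!Ec; apply: coindependent_pair.
- move=> i j; apply: principal_right_associates.
    by move=> /domR [/c0|/c0].
  by rewrite -!ideal_mul_principal -?Ec //; apply: invP.
Qed.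

(** The first two factors generate comaximal proper right ideals containing [a], which excludes
    rigidity. *)
Lemma rigid_factorization_semirigid a n (b : 'I_n -> R) :
  rigid_factorization a b -> semirigid a.
Proof.
move=> rfb; split; last by exists n, b.
have [n2 Ea invrig coma _] := rfb.
have ab i : ri_set (principal (b i)) a.
  apply: (@ideal_prod_sub _ _ (fun i => principal (b i))) => //.
    by move=> j; apply/right_invariant_left_stable; case: (invrig j).
  rewrite ideal_prod_principal; last by move=> j; case: (invrig j).
  by rewrite -Ea; apply: principal_id.
pose i0 := Ordinal (ltnW n2); pose i1 := Ordinal n2.
apply: (not_rigid_comaximal (ab i0) (ab i1)); first exact: coma.
  by case: (invrig i0) => _ [].
by case: (invrig i1) => _ [].
Qed.

Lemma invertible_serial a :
  invertible a -> has_serial_factorization (principal a).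
Proof.
(* The empty factorization; [principal 0] is a dummy value on an empty index type. *)
move=> /invertible_principal a1; exists 0%N, (fun=> principal 0); split.
- rewrite /ideal_prod big_ord0 -subTset => r _.
  by rewrite -(mul1r r); apply: principalM.
- by split; case.
- by case.
- by case.
Qed.

Lemma rigid_serial a : rigid a -> has_serial_factorization (principal a).
Proof.
move=> riga; have [a0 _ _] := riga.
have [pra uni] := (rigid_uniserial a0).1 riga.
exists 1%N, (fun=> principal a); split=> //.
  by rewrite /ideal_prod big_ord_recl big_ord0 ideal_mulrT.
split=> // i; apply/(ideal_addT1 _ (ri_bigcap (fun=> principal a) _)).
(* With one index the intersection is empty, hence all of [R], and [1 = 0 + 1]. *)
exists 0, 1; rewrite add0r; split=> //; first exact: ri0.
by move=> j; rewrite /= !ord1.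
Qed.

End BezoutDomain.

Theorem proposition4p2 (R : nzRingType) (HR : right_Bezout_domain R)
    (a : R) (Ha : a <> 0) :
  [/\ has_serial_factorization (principal a) <->
        [\/ invertible a, rigid a | semirigid a],
      forall (n : nat) (b : 'I_n -> R),
        semirigid a -> rigid_factorization a b ->
        serial_factorization (principal a) (fun i => principal (b i))
    & forall (n : nat) (A : 'I_n -> rightIdeal R),
        (2 <= n)%N -> serial_factorization (principal a) A ->
        (exists b : 'I_n -> R,
           (forall i, A i = principal (b i) :> set R) /\
           rigid_factorization a b) /\
        semirigid a].
Proof.
split.
(* The number of factors decides the case: none gives a unit, one a rigid element, two or more a
   semirigid one. *)
- split=> [[[|[|n]] [A serA]]|].
  + have [Ea _ _ _] := serA; constructor 1; apply/(invertible_principal HR).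
    by rewrite Ea /ideal_prod big_ord0.
  + have [Ea [prA _] _ uniA] := serA; constructor 2.
    have EA : A ord0 = principal a :> set R.
      by rewrite Ea /ideal_prod big_ord_recl big_ord0 ideal_mulrT.
    apply/(rigid_uniserial HR Ha); rewrite -EA; split=> //.
    by apply/uniserialP; rewrite -EA; apply/uniserialP.
  + constructor 3.
    have [//|b [_ rfb]] := serial_factorization_rigid HR Ha _ serA.
    exact: rigid_factorization_semirigid rfb.
  + case=> [|/(rigid_serial HR)//|[_ [n [b rfb]]]].
      exact: invertible_serial.
    by exists n, (fun i => principal (b i)); apply: rigid_factorization_serial.
- by move=> n b _; apply: rigid_factorization_serial.
- move=> n A n2 serA.
  have [b [Eb rfb]] := serial_factorization_rigid HR Ha n2 serA.
  by split; [exists b | apply: rigid_factorization_semirigid rfb].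
Qed.
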